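(* For any extensional $\mathbf{BI}(\_)^\bullet$-algebra $\mathcal{A}$ there is a PRO $\mathcal{C}_{\mathcal{A}}$ (a strict monoidal category whose objects are the natural numbers, with $m\otimes n=m+n$) whose arrows from $m$ to $n$ are the elements of $\mathcal{A}$ of arity $m\rightarrow n$, with composition of $a:l\to m$ and $b:m\to n$ given by $a\circ b$ and identities $\mathbf{I}$. In particular $\mathcal{C}_{\mathcal{A}}(m,1)=\mathcal{I}_{\mathcal{A}}(m)$ for all $m$.
   Context: An extensional $\mathbf{BI}(\_)^\bullet$-algebra is a set $\mathcal{A}$ with a binary application written by juxtaposition (left associative), elements $\mathbf{B},\mathbf{I}$ and a function $a\mapsto a^\bullet$ such that for all $a,b,c$: $\mathbf{I}\,a=a$; $\mathbf{B}\,a\,b\,c=a\,(b\,c)$; $a^\bullet\,b=b\,a$; $\mathbf{B}\,\mathbf{I}=\mathbf{I}$; $(a\,b)^\bullet=\mathbf{B}\,b^\bullet\,(\mathbf{B}\,a^\bullet\,\mathbf{B})$; $\mathbf{B}\,\mathbf{B}^\bullet\,(\mathbf{B}\,\mathbf{B}\,(\mathbf{B}\,\mathbf{B}\,\mathbf{B}))=\mathbf{B}\,(\mathbf{B}\,\mathbf{B})\,\mathbf{B}$; $\mathbf{B}\,\mathbf{I}^\bullet\,\mathbf{B}=\mathbf{I}$; $\mathbf{B}\,a^{\bullet\bullet}\,\mathbf{B}=\mathbf{B}\,(\mathbf{B}\,a^\bullet)\,\mathbf{B}$. Write $a\circ b=\mathbf{B}\,a\,b$ (associative with unit $\mathbf{I}$).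 Let $\mathbf{B}^0=\mathbf{I}$, $\mathbf{B}^{k+1}=\mathbf{B}\circ\mathbf{B}^k$. An element $a$ is of arity $m\rightarrow n$ when $a^\bullet\circ\mathbf{B}^{m+1}=(\mathbf{B}\,a)\circ\mathbf{B}^n$. The internal operad has $\mathcal{I}_{\mathcal{A}}(m)=\{a^\bullet\circ\mathbf{B}^m\mid a\in\mathcal{A}\}$. *)

(* Defs.v *)
From Stdlib Require Import Arith.

Set Implicit Arguments.
Unset Strict Implicit.

(* Extensional BI(_)^bullet-algebras; [bul a] is a^bullet. *)
Record extBIbul := ExtBIbul {
  carrier :> Type;
  app : carrier -> carrier -> carrier;
  Bc : carrier;
  Ic : carrier;
  bul : carrier -> carrier;
  app_I : forall a, app Ic a = a;
  app_B : forall a b c, app (app (app Bc a) b) c = app a (app b c);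
  app_bul : forall a b, app (bul a) b = app b a;
  BI_I : app Bc Ic = Ic;
  bul_app : forall a b,
    bul (app a b) = app (app Bc (bul b)) (app (app Bc (bul a)) Bc);
  bul_B :
    app (app Bc (bul Bc)) (app (app Bc Bc) (app (app Bc Bc) Bc))
    = app (app Bc (app Bc Bc)) Bc;
  bul_I : app (app Bc (bul Ic)) Bc = Ic;
  bul_bul : forall a,
    app (app Bc (bul (bul a))) Bc = app (app Bc (app Bc (bul a))) Bc
}.

Arguments Bc {_}.
Arguments Ic {_}.

Definition comp (A : extBIbul) (a b : A) : A := app (app Bc a) b.

Fixpoint Bpow (A : extBIbul) (k : nat) : A :=
  match k with
  | 0 => Ic
  | S k => comp Bc (Bpow A k)
  end.

Definition has_arity (A : extBIbul) (m n : nat) (a : A) : Prop :=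
  comp (bul a) (Bpow A (m + 1)) = comp (app Bc a) (Bpow A n).

(* The underlying set of I_A(m), as a predicate on A. *)
Definition internal_operad (A : extBIbul) (m : nat) (x : A) : Prop :=
  exists a : A, x = comp (bul a) (Bpow A m).

Definition cast_hom (ob : Type) (hom : ob -> ob -> Type) (x x' y y' : ob)
    (ex : x = x') (ey : y = y') (f : hom x y) : hom x' y' :=
  match ex in _ = u, ey in _ = v return hom u v with
  | eq_refl, eq_refl => f
  end.

(* Strict monoidal category structures on given objects, hom-sets, tensor of
   objects and unit object. [seq f g] is composition in diagrammatic order,
   f first. Strictness on arrows only typechecks up to the transport of hom
   along the equations between objects. *)
Record strict_monoidal (ob : Type) (hom : ob -> ob -> Type)
    (tob : ob -> ob -> ob) (unit : ob) := StrictMonoidal {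
  idm : forall x, hom x x;
  seq : forall x y z, hom x y -> hom y z -> hom x z;
  tensor : forall x y x' y',
    hom x y -> hom x' y' -> hom (tob x x') (tob y y');
  seq_idl : forall x y (f : hom x y), seq (idm x) f = f;
  seq_idr : forall x y (f : hom x y), seq f (idm y) = f;
  seq_assoc : forall x y z w (f : hom x y) (g : hom y z) (h : hom z w),
    seq f (seq g h) = seq (seq f g) h;
  tensor_id : forall x y, tensor (idm x) (idm y) = idm (tob x y);
  tensor_seq : forall x y z x' y' z'
      (f : hom x y) (g : hom y z) (f' : hom x' y') (g' : hom y' z'),
    tensor (seq f g) (seq f' g') = seq (tensor f f') (tensor g g');
  tob_unitl : forall x, tob unit x = x;
  tob_unitr : forall x, tob x unit = x;
  tob_assoc : forall x y z, tob x (tob y z) = tob (tob x y) z;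
  tensor_unitl : forall x y (f : hom x y),
    cast_hom (tob_unitl x) (tob_unitl y) (tensor (idm unit) f) = f;
  tensor_unitr : forall x y (f : hom x y),
    cast_hom (tob_unitr x) (tob_unitr y) (tensor f (idm unit)) = f;
  tensor_assoc : forall x y x' y' x'' y''
      (f : hom x y) (g : hom x' y') (h : hom x'' y''),
    cast_hom (tob_assoc x x' x'') (tob_assoc y y' y'')
      (tensor f (tensor g h)) = tensor (tensor f g) h
}.

Definition PRO (hom : nat -> nat -> Type) : Type :=
  strict_monoidal hom Nat.add 0.

Definition arrows (A : extBIbul) (m n : nat) : Type :=
  {a : A | has_arity m n a}.

(* Main.v *)
(** Write [β x] for [B x].  The axioms say that [∘] is a monoid with unit [I],
    that [β] is a monoid endomorphism, and that [x ∘ a^• = a^• ∘ β x].  An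
    element [a] of arity [m → n] satisfies [β^m x ∘ a = a ∘ β^n x] for all [x],
    so [a ⊗ b := a ∘ β^n b] obeys the interchange law.  Since [B] has arity
    [2 → 1] and [a^•] has arity [0 → 1], [a^• ∘ B^m] has arity [m → 1];
    conversely, if [x] has arity [m → 1] then [x = (x I)^• ∘ B^m]. *)

Require Import Defs.
From Stdlib Require Import Arith ProofIrrelevance.

Local Infix "∘" := comp (at level 40, left associativity).

Section Algebra.
Variable A : extBIbul.
Implicit Types a b c x y : A.

Lemma comp_app a b x : app (a ∘ b) x = app a (app b x).
Proof. apply app_B. Qed.

Lemma comp_I_l a : Ic ∘ a = a.
Proof. unfold comp. now rewrite BI_I, app_I. Qed.

(** Evaluate the closed axiom [bul_I] at [a]. [app_B_comp] and [comp_bul] are read off [bul_B] and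
    [bul_bul] in the same way. *)
Lemma comp_I_r a : a ∘ Ic = a.
Proof.
  pose proof (f_equal (fun t => app t a) (bul_I A)) as H; cbn in H.
  now rewrite app_B, app_bul, app_I in H.
Qed.

Lemma app_B_comp a b : app Bc (a ∘ b) = app Bc a ∘ app Bc b.
Proof.
  pose proof (f_equal (fun t => app (app t a) b) (bul_B A)) as H; cbn in H.
  rewrite !app_B, app_bul, !app_B in H.
  symmetry; exact H.
Qed.

Lemma comp_assoc a b c : a ∘ (b ∘ c) = a ∘ b ∘ c.
Proof.
  pose proof (f_equal (fun t => app t c) (app_B_comp a b)) as H; cbn in H.
  rewrite comp_app in H. symmetry; exact H.
Qed.

Lemma comp_bul a x : x ∘ bul a = bul a ∘ app Bc x.
Proof.
  pose proof (f_equal (fun t => app t x) (bul_bul a)) as H; cbn in H.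
  rewrite !app_B, app_bul in H. exact H.
Qed.

Lemma bul_app_comp a b : bul (app a b) = bul b ∘ bul a ∘ Bc.
Proof. rewrite bul_app. apply comp_assoc. Qed.

Lemma Bpow_add m n : Bpow A (m + n) = Bpow A m ∘ Bpow A n.
Proof.
  induction m as [|m IH]; simpl.
  - now rewrite comp_I_l.
  - now rewrite IH, comp_assoc.
Qed.

Lemma Bpow_1 : Bpow A 1 = Bc.
Proof. apply comp_I_r. Qed.

Lemma app_Bpow_I m : app (Bpow A m) Ic = Ic.
Proof.
  induction m as [|m IH]; simpl.
  - apply app_I.
  - now rewrite comp_app, IH, BI_I.
Qed.

Lemma app_Bpow_comp m a b :
  app (Bpow A m) (a ∘ b) = app (Bpow A m) a ∘ app (Bpow A m) b.
Proof.
  induction m as [|m IH]; simpl.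
  - now rewrite !app_I.
  - now rewrite !comp_app, IH, app_B_comp.
Qed.

(** Splitting off the extra [Bc] isolates the factor [bul a ∘ Bc], which behaves well under
    composition (see [bul_comp]). *)
Lemma has_arityE m n a :
  has_arity m n a <-> bul a ∘ Bc ∘ Bpow A m = app Bc a ∘ Bpow A n.
Proof.
  unfold has_arity. rewrite Nat.add_1_r; simpl.
  now rewrite comp_assoc.
Qed.

(** Evaluate the arity equation at [x]; [app_bul] turns the left side into a composite ending in
    [a]. *)
Lemma has_arity_natural m n a x :
  has_arity m n a -> app (Bpow A m) x ∘ a = a ∘ app (Bpow A n) x.
Proof.
  intros H%has_arityE%(f_equal (fun t => app t x)).
  rewrite !comp_app, app_bul in H. exact H.
Qed.

Lemma has_arity_B : has_arity 2 1 (@Bc A).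
Proof.
  apply has_arityE. simpl. rewrite !comp_I_r, <- comp_assoc. exact (bul_B A).
Qed.

Lemma comp_B_app_B x : Bc ∘ app Bc x = app Bc (app Bc x) ∘ Bc.
Proof.
  pose proof (has_arity_natural _ _ _ x has_arity_B) as H; simpl in H.
  rewrite !comp_I_r, comp_app in H. symmetry; exact H.
Qed.

(** The left side expands to [bul a] followed by the left side of the arity equation of [Bc];
    [comp_bul] then carries [Bc] past [bul a]. *)
Lemma bul_app_B a : bul (app Bc a) ∘ Bc ∘ Bc = Bc ∘ bul a ∘ Bc.
Proof.
  pose proof (proj1 (has_arityE _ _ _) has_arity_B) as H; simpl in H.
  rewrite !comp_I_r, comp_assoc in H.
  now rewrite bul_app_comp, (comp_bul a Bc), <- !comp_assoc, <- H, <- !comp_assoc.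
Qed.

(** Thus [a ↦ bul a ∘ Bc] reverses composition, which is what makes arities compose. *)
Lemma bul_comp a b : bul (a ∘ b) ∘ Bc = bul b ∘ Bc ∘ bul a ∘ Bc.
Proof.
  unfold comp at 2. rewrite bul_app_comp.
  rewrite <- !comp_assoc. f_equal.
  rewrite !comp_assoc. apply bul_app_B.
Qed.

Lemma has_arity_I m : has_arity m m (@Ic A).
Proof.
  apply has_arityE. rewrite BI_I. f_equal. apply bul_I.
Qed.

Lemma has_arity_comp l m n a b :
  has_arity l m a -> has_arity m n b -> has_arity l n (a ∘ b).
Proof.
  rewrite !has_arityE. intros Ha Hb.
  rewrite bul_comp, <- !comp_assoc, (comp_assoc (bul a)), Ha.
  (* Carry [app Bc a] to the front, past [Bc] and then [bul b], so that the arity equation of [b]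
     applies. *)
  rewrite (comp_assoc Bc), comp_B_app_B, !comp_assoc, <- comp_bul.
  rewrite <- !comp_assoc, (comp_assoc (bul b)), Hb.
  now rewrite app_B_comp, comp_assoc.
Qed.

Lemma has_arity_addr k m n a : has_arity m n a -> has_arity (m + k) (n + k) a.
Proof.
  rewrite !has_arityE, !Bpow_add, !comp_assoc. now intros ->.
Qed.

Lemma has_arity_addl k m n a :
  has_arity m n a -> has_arity (k + m) (k + n) (app (Bpow A k) a).
Proof.
  intros Ha. induction k as [|k IH]; simpl.
  - now rewrite app_I.
  - rewrite comp_app. set (b := app (Bpow A k) a) in *.
    apply has_arityE. apply has_arityE in IH. simpl.
    rewrite comp_assoc, bul_app_B, <- !comp_assoc, (comp_assoc (bul b)), IH.
    now rewrite comp_assoc, comp_B_app_B, comp_assoc.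
Qed.

(** The tensor is [a ⊗ id] followed by [id ⊗ b], through the object [n + m']. *)
Lemma has_arity_tensor m n m' n' a b :
  has_arity m n a -> has_arity m' n' b ->
  has_arity (m + m') (n + n') (a ∘ app (Bpow A n) b).
Proof.
  intros Ha Hb. apply has_arity_comp with (n + m').
  - now apply has_arity_addr.
  - now apply has_arity_addl.
Qed.

Lemma has_arity_Bpow m : has_arity (1 + m) 1 (Bpow A m).
Proof.
  induction m as [|m IH].
  - apply has_arity_I.
  - apply has_arity_comp with (1 + m); [|exact IH].
    (* The leading [Bc] of the power is read as an arrow [2 + m → 1 + m]. *)
    exact (has_arity_addr m 2 1 _ has_arity_B).
Qed.

Lemma has_arity_bul a : has_arity 0 1 (bul a).
Proof.
  apply has_arityE. rewrite Bpow_1. simpl. rewrite comp_I_r. apply bul_bul.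
Qed.

Lemma has_arity_1_iff m x : has_arity m 1 x <-> internal_operad m x.
Proof.
  split.
  - intros H%has_arityE. exists (app x Ic).
    rewrite bul_app_comp, <- !comp_assoc, (comp_assoc (bul x)), H.
    (* What remains is [bul Ic ∘ app Bc x ∘ Bc]; moving [x] to the front leaves [bul Ic ∘ Bc], which
       is [Ic]. *)
    rewrite comp_assoc, <- comp_bul, Bpow_1, <- comp_assoc.
    change (bul Ic ∘ Bc) with (app (app Bc (bul (@Ic A))) Bc).
    now rewrite bul_I, comp_I_r.
  - intros [a ->]. apply has_arity_comp with (1 + m).
    + exact (has_arity_addr m 0 1 _ (has_arity_bul a)).
    + apply has_arity_Bpow.
Qed.

(** Arities are equations in an arbitrary type, so proof irrelevance is what identifies arrows with
    their underlying elements. *)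
Lemma arrows_eq m n (f g : arrows A m n) : proj1_sig f = proj1_sig g -> f = g.
Proof.
  apply eq_sig_hprop. intros; apply proof_irrelevance.
Qed.

(** Reduces the strictness laws to equations in [A]. *)
Lemma cast_hom_val m m' n n' (em : m = m') (en : n = n') (f : arrows A m n) :
  proj1_sig (cast_hom em en f) = proj1_sig f.
Proof. now destruct em, en. Qed.

Definition arrow_id m : arrows A m m := exist _ Ic (has_arity_I m).

Definition arrow_comp l m n (f : arrows A l m) (g : arrows A m n) :
    arrows A l n :=
  exist _ (proj1_sig f ∘ proj1_sig g)
    (has_arity_comp _ _ _ _ _ (proj2_sig f) (proj2_sig g)).

Definition arrow_tensor m n m' n' (f : arrows A m n) (g : arrows A m' n') :
    arrows A (m + m') (n + n') :=
  exist _ (proj1_sig f ∘ app (Bpow A n) (proj1_sig g))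
    (has_arity_tensor _ _ _ _ _ _ (proj2_sig f) (proj2_sig g)).

Definition arrows_PRO : PRO (arrows A).
Proof.
  refine (@StrictMonoidal nat (arrows A) Nat.add 0
    arrow_id arrow_comp arrow_tensor _ _ _ _ _
    (fun n => eq_refl) Nat.add_0_r Nat.add_assoc _ _ _);
    intros; apply arrows_eq; rewrite ?cast_hom_val; simpl.
  - apply comp_I_l.
  - apply comp_I_r.
  - apply comp_assoc.
  - now rewrite app_Bpow_I, comp_I_l.
  (* Interchange: cancelling the outer factors leaves the naturality of [g] at the element of
     [f']. *)
  - rewrite app_Bpow_comp, !comp_assoc. f_equal.
    rewrite <- !comp_assoc. f_equal.
    symmetry. apply has_arity_natural, (proj2_sig g).
  - now rewrite app_I, comp_I_l.
  - now rewrite app_Bpow_I, comp_I_r.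
  - now rewrite app_Bpow_comp, Bpow_add, comp_app, comp_assoc.
Defined.

End Algebra.

Theorem theorem4p4 (A : extBIbul) :
  (exists C : PRO (arrows A),
     (forall (l m n : nat) (a : arrows A l m) (b : arrows A m n),
        proj1_sig (seq C a b) = comp (proj1_sig a) (proj1_sig b)) /\
     (forall m : nat, proj1_sig (idm C m) = Ic)) /\
  (forall (m : nat) (x : A), has_arity m 1 x <-> internal_operad m x).
Proof.
  split.
  - now exists (arrows_PRO A).
  - apply has_arity_1_iff.
Qed.
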